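(* Let $n\in\mathbb{Z}$, $n\ge 1$, and let $a_n=[z^n]\,e^{z/(1-z)}$. Then $$a_n = e^{-1}M(n+1,2,1).$$
   Context: For a function $f$ analytic in the open unit disk $\{z\in\mathbb{C}:|z|<1\}$, $[z^n]f(z)$ denotes the coefficient of $z^n$ in its Maclaurin series. $M(a,b,z)$ is Kummer's confluent hypergeometric function $M(a,b,z)={}_1F_1(a;b;z)=\sum_{k\ge 0}\frac{(a)_k\,z^k}{(b)_k\,k!}$ (for $b$ not zero or a negative integer), where $(x)_k:=x(x+1)\cdots(x+k-1)$ is the ascending factorial (Pochhammer symbol), with $(x)_0=1$. *)

(* Defs.v *)
From mathcomp Require Import all_boot all_order all_algebra.
From mathcomp Require Import complex.
From mathcomp Require Import all_classical all_reals all_analysis.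

Set Implicit Arguments.
Unset Strict Implicit.
Unset Printing Implicit Defensive.

Import Order.TTheory GRing.Theory Num.Theory.
Import numFieldNormedType.Exports.

Local Open Scope classical_set_scope.
Local Open Scope ring_scope.

(* e^(x + iy) = e^x (cos y + i sin y). *)
Definition cexp (R : realType) (z : R[i]) : R[i] :=
  ((expR (complex.Re z) * cos (complex.Im z)) +i*
   (expR (complex.Re z) * sin (complex.Im z)))%C.

(* [z^n] f(z) = f^(n)(0) / n!.  For K = R[i] the difference quotients in
   [derive1n] have complex increments, so these are complex derivatives. *)
Definition maclaurin_coef (K : numFieldType) (f : K -> K) (n : nat) : K :=
  derive1n n f 0 / n`!%:R.

Definition pochhammer (K : numFieldType) (x : K) (k : nat) : K :=
  \prod_(i < k) (x + i%:R).

(* Meaningful only when b is not zero or a negative integer. *)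
Definition kummerM (K : numFieldType) (a b z : K) : K :=
  lim (series (fun k : nat =>
    pochhammer a k * z ^+ k / (pochhammer b k * k`!%:R)) @ \oo).

(* Main.v *)
Require Import Defs.
From mathcomp Require Import all_boot all_order all_algebra.
From mathcomp Require Import complex.
From mathcomp Require Import all_classical all_reals all_analysis.
From mathcomp Require Import ring lra zify.

Import Order.TTheory GRing.Theory Num.Theory.
Import numFieldNormedType.Exports.

Local Open Scope ring_scope.

(** Write n = N + 1 and w = 1 / (1 - z).  Both sides of the identity are
    reduced to the finite sum of the C(N, m) / (m + 1)! over m <= N, that is,
    to the sum of the Lah numbers of index n divided by n!.

    Left-hand side.  Since z / (1 - z) = w - 1 and w' = w ^ 2, all derivatives
    of f = e^(w - 1) are f times a polynomial in w.  Explicitly,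
      f^(N+1) = (N+1)! w^(N+2) A_N(w) f,
    where A_N has the coefficients C(N, m) / (m + 1)!.  The induction step
    [is_derive1_lah_fun] is the polynomial identity [lah_poly_rec],
      (N+2) A_(N+1) = (N+2) A_N + X A_N' + X A_N,
    which comes down to (m + 1) C(N, m+1) = (N - m) C(N, m).  At z = 0 one has
    w = f = 1, so the coefficient is A_N(1) ([maclaurin_coef_exp_mobius]).

    Right-hand side.  The k-th term of M(N+2, 2, 1) is C(N+k+1, k) / (k+1)!.
    Vandermonde's convolution of C(N, m) and C(k+1, k-m) turns it into the sum
    over m <= min(N, k) of C(N, m) / (m+1)! * 1 / (k-m)! ([kummer_term]): the
    series is the Cauchy product of a finite sequence with sum A_N(1) and of
    the series of e.  Hence M(N+2, 2, 1) = e A_N(1) ([kummerM_lah]).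

    What remains is that the function e^x (cos y + i sin y) is its own complex
    derivative ([is_derive1_cexp]); its addition formula reduces this to the
    point 0, where the first-order expansions of the real exp, sin and cos
    suffice ([cvg_cexp_quotient]). *)

(** * Derivative rules over a number field *)

Section derivative_rules.
Local Open Scope classical_set_scope.
Variable K : numFieldType.
Implicit Types (f g : K -> K) (p : {poly K}) (x a df dg : K).

Lemma is_derive1_chain {f g x df dg} :
  is_derive x 1 g dg -> is_derive (g x) 1 f df ->
  is_derive x 1 (fun z => f (g z)) (df * dg).
Proof.
move=> [/derivable1_diffP g_diff g_der] [/derivable1_diffP f_diff f_der].
have fg_diff : differentiable (f \o g) x by exact: differentiable_comp.
apply: DeriveDef; first exact/derivable1_diffP.
rewrite -f_der -g_der -!derive1E !derive1E' // diff_comp //=.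
by rewrite -[X in 'd f _ X]mulr1 [LHS]linearZ mulrC.
Qed.

Lemma is_derive1_horner p x : is_derive x 1 (horner p) p^`().[x].
Proof.
elim/poly_ind: p => [|p c IHp].
  have -> : horner (0 : {poly K}) = cst 0 by apply/funext => y; rewrite horner0.
  by rewrite deriv0 horner0; exact: is_derive_cst.
have -> : horner (p * 'X + c%:P) = (horner p * id) + cst c.
  by apply/funext => y; rewrite !hornerE.
apply: (is_derive_eq (is_deriveD _ _)).
rewrite derivD derivM derivX derivC !hornerE /=.
rewrite /GRing.scale /=; ring.
Qed.

Lemma is_derive1_inv1B x : x != 1 ->
  is_derive x 1 (fun z => (1 - z)^-1) ((1 - x)^-1 ^+ 2).
Proof.
move=> x_neq1; pose f : K -> K := fun z => 1 - z.
have fx_neq0 : f x != 0 by rewrite subr_eq0 eq_sym.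
have [f_derivable f_der] : is_derive x 1 f (0 - 1) by exact: is_deriveB.
apply: DeriveDef; first exact: (@derivableV _ _ f).
rewrite (@deriveV _ _ f) // f_der.
by rewrite /GRing.scale /= sub0r mulrN1 opprK exprVn.
Qed.

Lemma near_neq x a : x != a -> \forall u \near x, u != a.
Proof.
move=> x_neq_a; exists `|x - a|; first by rewrite /= normr_gt0 subr_eq0.
by move=> u /= u_close; apply: contraL u_close => /eqP ->; rewrite ltxx.
Qed.

End derivative_rules.

(** * Lah polynomials and the terms of Kummer's series *)

Section lah.
Variable K : numFieldType.
Implicit Types (N m k : nat).

(** With n = N + 1 and k = m + 1, this is L(n, k) / n! for the Lah number
    L(n, k) = C(n - 1, k - 1) n! / k!. *)
Definition lah_coef N m : K := 'C(N, m)%:R / m.+1`!%:R.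

Definition lah_poly N : {poly K} := \poly_(m < N.+1) lah_coef N m.

Let fact_neq0 k : k`!%:R != 0 :> K.
Proof. by rewrite pnatr_eq0 -lt0n fact_gt0. Qed.

(** Over the common denominator (m + 2)!, the difference of the two sides is
    (N - m) C(N, m) - (m + 1) C(N, m + 1) after Pascal's rule. *)
Lemma lah_coef_rec N m :
  N.+2%:R * lah_coef N.+1 m.+1 =
  (N + m.+3)%:R * lah_coef N m.+1 + lah_coef N m.
Proof.
have binSE : (N%:R - m%:R) * 'C(N, m)%:R = m.+1%:R * 'C(N, m.+1)%:R :> K.
  (* For m > N, the factor N - m is negative but both binomials vanish. *)
  have [le_mN|lt_Nm] := leqP m N.
    by rewrite -natrB // -!natrM mul_bin_left.
  by rewrite !bin_small ?mulr0 // ltnW.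
apply/eqP; rewrite -subr_eq0 /lah_coef binS natrD (factS m.+1) natrM.
set lhs := (X in X == 0).
have -> : lhs = ((N%:R - m%:R) * 'C(N, m)%:R - m.+1%:R * 'C(N, m.+1)%:R)
                / (m.+2%:R * m.+1`!%:R).
  rewrite {}/lhs; have := fact_neq0 m.+1.
  have : m.+2%:R != 0 :> K by rewrite pnatr_eq0.
  move: (m.+1`!%:R) => F m2 F0.
  rewrite natrD !mulrSr in m2 *.
  by field; rewrite F0 m2.
by rewrite binSE subrr mul0r.
Qed.

Lemma coef_lah_poly N m : (lah_poly N)`_m = lah_coef N m.
Proof.
rewrite coef_poly ltnS; case: leqP => // lt_Nm.
by rewrite /lah_coef bin_small // mul0r.
Qed.

(** Differentiation of w^(N+2) A_N(w) e^w with respect to z, where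
    w' = w ^ 2, produces w^(N+3) e^w times the value at w of the right-hand side. *)
Lemma lah_poly_rec N :
  N.+2%:R *: lah_poly N.+1 =
  N.+2%:R *: lah_poly N + 'X * (lah_poly N)^`() + 'X * lah_poly N.
Proof.
apply/polyP => -[|m].
  by rewrite !coefD !coefZ !coefXM !coef_lah_poly /= !addr0 /lah_coef !bin0.
rewrite !coefD !coefZ !coefXM coef_deriv !coef_lah_poly /= lah_coef_rec.
rewrite -[lah_coef N m.+1 *+ _]mulr_natl -mulrDl -natrD.
by congr (_%:R * _ + _); lia.
Qed.

Lemma pochhammer_nat N k :
  pochhammer (N.+1%:R : K) k = (N + k)`!%:R / N`!%:R.
Proof.
elim: k => [|k IHk]; rewrite /pochhammer.
  by rewrite big_ord0 addn0 divff.
rewrite big_ord_recr /= -/(pochhammer _ _) IHk addnS factS natrM -natrD addSn.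
by rewrite mulrAC [_.+1%:R * _]mulrC.
Qed.

Lemma sum_ord_support {V : nmodType} (F : nat -> V) a b :
  (forall i, (a <= i)%N -> F i = 0) -> (forall i, (b <= i)%N -> F i = 0) ->
  \sum_(i < a) F i = \sum_(i < b) F i.
Proof.
wlog le_ab : a b / (a <= b)%N => [hwlog Fa Fb|Fa _].
  by case/orP: (leq_total a b) => le; [|symmetry]; exact: hwlog.
rewrite (big_ord_widen b F le_ab) big_mkcond.
by apply: eq_bigr => i _; case: ltnP => // /Fa ->.
Qed.

(** The pochhammer quotient is C(N + (k + 1), k) / (k + 1)!, to which
    Vandermonde's convolution applies; the indicator of m <= k lets the sum run
    over a range independent of k, so that it can be exchanged with the sum
    of the series. *)
Lemma kummer_term N k :
  pochhammer (N.+2%:R : K) k * 1 ^+ k / (pochhammer 2 k * k`!%:R) =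
  \sum_(m < N.+1) lah_coef N m * ((m <= k)%N%:R / (k - m)`!%:R).
Proof.
rewrite expr1n mulr1 !pochhammer_nat.
have -> : (N.+1 + k)`!%:R = 'C(N + k.+1, k)%:R * k`!%:R * N.+1`!%:R :> K.
  rewrite -!natrM -mulnA -(bin_fact (leq_addl N.+1 k)) addnK addSnnS.
  by congr (_%:R); lia.
rewrite -binomial.Vandermonde natr_sum add1n (_ : 1`!%:R = 1) // divr1.
transitivity (\sum_(j < k.+1) 'C(N, j)%:R * 'C(k.+1, k - j)%:R / k.+1`!%:R : K).
  rewrite -mulr_suml; under [X in _ = X / _]eq_bigr do rewrite -natrM.
  move: (\sum_(j < k.+1) _) (fact_neq0 k) (fact_neq0 k.+1) (fact_neq0 N.+1) => S.
  move: (k`!%:R) (k.+1`!%:R) (N.+1`!%:R) => a b c a_neq0 b_neq0 c_neq0.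
  by field; rewrite a_neq0 b_neq0 c_neq0.
pose F m := lah_coef N m * ((m <= k)%N%:R / (k - m)`!%:R).
rewrite [RHS](sum_ord_support F N.+1 k.+1) /F.
- apply: eq_bigr => -[j /=]; rewrite ltnS => le_jk _.
  rewrite le_jk -(@bin_fact k.+1 (k - j)) ?leq_subLR; last by lia.
  rewrite subSn ?leq_subr // subKn // 2!natrM /lah_coef (_ : true%:R = 1) //.
  have C0 : 'C(k.+1, k - j)%:R != 0 :> K.
    by rewrite pnatr_eq0 -lt0n bin_gt0; lia.
  move: C0 (fact_neq0 (k - j)) (fact_neq0 j.+1).
  move: ('C(k.+1, _)%:R) ((k - j)`!%:R) (j.+1`!%:R) => a b c.
  by move=> a_neq0 b_neq0 c_neq0; field; rewrite a_neq0 b_neq0 c_neq0.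
- by move=> i le_Ni; rewrite /lah_coef bin_small // !mul0r.
- by move=> i le_ki; rewrite leqNgt le_ki mul0r mulr0.
Qed.

End lah.

(** * The complex exponential *)

Section complex_exponential.
Local Open Scope classical_set_scope.
Variable R : realType.
(* The ascription makes limits and derivatives refer to R[i] as a normed space
   over itself, so that derivatives are complex ones. *)
Local Notation C := (R[i] : numFieldType).
Implicit Types (x y : R) (z w : C).

Lemma cexpD z w : cexp (z + w) = cexp z * cexp w.
Proof.
case: z w => [a b] [c d]; rewrite /cexp /= expRD cosD sinD.
by apply/eqP; rewrite eq_complex /=; apply/andP; split; apply/eqP; ring.
Qed.

Lemma cexp0 : cexp 0 = 1 :> C.
Proof. by rewrite /cexp /= expR0 cos0 sin0 mulr1 mulr0. Qed.

Lemma cexp_real x : cexp x%:C%C = (expR x)%:C%C :> C.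
Proof. by rewrite /cexp /= cos0 sin0 mulr1 mulr0. Qed.

Lemma first_order_bound {f : R -> R} {df e : R} :
  0 < e -> is_derive (0 : R) 1 f df ->
  exists2 d, 0 < d & forall x, `|x| < d -> `|f x - f 0 - df * x| <= e * `|x|.
Proof.
move=> e_gt0 [f_derivable f_der].
move: f_derivable => /cvgrPdist_le /(_ e e_gt0); rewrite -/(derive f 0 1) f_der.
move=> [d /= d_gt0 near_quot]; exists d => // x x_lt_d.
have [->|x_neq0] := eqVneq x 0.
  by rewrite subrr mulr0 subr0 normr0 mulr0.
have := near_quot x; rewrite /= sub0r normrN addr0 => /(_ x_lt_d x_neq0).
rewrite -(ler_pM2r (_ : 0 < `|x|)) ?normr_gt0 // -normrM distrC.
rewrite /GRing.scale /= mulr1 mulrBl mulrAC mulVf // mul1r.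
by rewrite distrC.
Qed.

Lemma norm_real_complex x : `|x%:C%C : C| = `|x|%:C%C.
Proof. by rewrite normc_def /= expr0n addr0 sqrtr_sqr. Qed.

Lemma norm_imaginary y : `|(0 +i* y)%C : C| = `|y|%:C%C.
Proof. by rewrite normc_def /= expr0n add0r sqrtr_sqr. Qed.

Lemma complex_norm_le x y : `|(x +i* y)%C : C| <= (`|x| + `|y|)%:C%C.
Proof.
have -> : (x +i* y)%C = x%:C%C + (0 +i* y)%C :> C.
  by apply/eqP; rewrite eq_complex /= addr0 add0r !eqxx.
by rewrite (le_trans (ler_normD _ _)) // norm_real_complex norm_imaginary rmorphD.
Qed.

Lemma norm_cis y : `|(cos y +i* sin y)%C : C| = 1.
Proof. by rewrite normc_def /= cos2Dsin2 sqrtr1. Qed.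

(** A positive complex number is real, so the epsilons of the limits in R[i] can
    be taken in R. *)
Lemma pos_complexP (e : C) : 0 < e -> exists2 r : R, 0 < r & e = r%:C%C.
Proof.
case: e => r i; rewrite ltcE /= => /andP[/eqP -> r_gt0].
by exists r.
Qed.

Lemma normc_ge_Im z : `|complex.Im z|%:C%C <= `|z|.
Proof.
case: z => x y; rewrite normc_def lecR /= -sqrtr_sqr ler_wsqrtr //.
by rewrite lerDr sqr_ge0.
Qed.

(** For h = x + iy,
      e^h - 1 - h = (e^x - 1 - x) cis y + (1 + x) (cis y - 1 - iy) + ixy,
    with cis y = cos y + i sin y of norm 1: each summand is o(|h|), the first
    two by the derivatives of exp, cos and sin at 0 and the last one because
    it is quadratic. *)
Lemma cvg_cexp_quotient :
  (h^-1 * (cexp h - 1) : C) @[h --> (0 : C)^'] --> (1 : C).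
Proof.
apply/cvgrPdist_le => _ /pos_complexP[e e_gt0 ->].
(* The three summands contribute 1 + 2 * 2 + 1 = 6 times d |h|: the factor
   1 + x is at most 2, and cis y - 1 - iy has two components. *)
pose d := e / 6; have d_gt0 : 0 < d by rewrite divr_gt0.
have [d1 d1_gt0 exp_le] := first_order_bound d_gt0 (is_derive_expR 0).
have [d2 d2_gt0 sin_le] := first_order_bound d_gt0 (is_derive_sin 0).
have [d3 d3_gt0 cos_le] := first_order_bound d_gt0 (is_derive_cos 0).
pose m := Num.min (Num.min d1 d2) (Num.min d3 (Num.min d 1)).
exists m%:C%C => /=.
  by rewrite ltcR !lt_min d1_gt0 d2_gt0 d3_gt0 d_gt0 ltr01.
move=> [x y] /=; rewrite sub0r normrN => h_lt h_neq0.
have x_le := normc_ge_Re (x +i* y)%C; have y_le := normc_ge_Im (x +i* y)%C.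
have {h_lt}[r r_def r_lt] : exists2 r : R, `|(x +i* y)%C| = r%:C%C & r < m.
  by move: h_lt; rewrite normc_def ltcR => r_lt; eexists; last exact: r_lt.
rewrite r_def !lecR /= in x_le y_le.
move: r_lt; rewrite !lt_min => /andP[/andP[r1 r2] /and3P[r3 r4 r5]].
have {exp_le} := exp_le x (le_lt_trans x_le r1).
have {sin_le} := sin_le y (le_lt_trans y_le r2).
have {cos_le} := cos_le y (le_lt_trans y_le r3).
rewrite expR0 cos0 sin0 subr0 oppr0 mul0r !mul1r subr0 => cos_le sin_le exp_le.
have r_ge0 : 0 <= r by exact: le_trans x_le.
have r_gt0 : 0 < r.
  rewrite lt_neqAle r_ge0 andbT; apply: contra h_neq0 => /eqP r0.
  by rewrite -normr_eq0 r_def -r0.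
set h := (x +i* y)%C.
have -> : 1 - h^-1 * (cexp h - 1) = - (h^-1 * (cexp h - 1 - h)).
  by rewrite [in RHS]mulrBr mulVf // opprB.
rewrite normrN normrM normfV r_def.
rewrite mulrC ler_pdivrMr ?ltcR // -rmorphM /=.
have -> : cexp h - 1 - h = (expR x - 1 - x)%:C%C * (cos y +i* sin y)%C +
    (1 + x)%:C%C * ((cos y - 1) +i* (sin y - y))%C + (0 +i* (x * y))%C.
  by apply/eqP; rewrite eq_complex /=; apply/andP; split; apply/eqP; ring.
have bound : `|expR x - 1 - x| + `|1 + x| * (`|cos y - 1| + `|sin y - y|)
             + `|x * y| <= e * r.
  have B_le : `|1 + x| <= 2 by rewrite (le_trans (ler_normD _ _)) // normr1; lra.
  have dr_ge0 : 0 <= d * r by rewrite mulr_ge0 // ltW.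
  have dx_le : d * `|x| <= d * r by rewrite ler_wpM2l // ltW.
  have dy_le : d * `|y| <= d * r by rewrite ler_wpM2l // ltW.
  have sum_le : `|cos y - 1| + `|sin y - y| <= 2 * (d * r).
    move: cos_le sin_le dy_le; lra.
  have prod_le := ler_pM (normr_ge0 _) (addr_ge0 (normr_ge0 _) (normr_ge0 _))
                         B_le sum_le.
  have xy_le : `|x * y| <= d * r.
    by rewrite normrM ler_pM // (le_trans x_le) // ltW.
  have -> : e * r = 6 * (d * r) by rewrite /d; field.
  lra.
apply: le_trans (_ : _ <= (_ : R)%:C%C) _; last by rewrite lecR; exact: bound.
move: (expR x - 1 - x) (1 + x) => u v.
rewrite 2!rmorphD rmorphM /=.
apply: le_trans (ler_normD _ _) _; rewrite norm_imaginary lerD2r.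
apply: le_trans (ler_normD _ _) _.
rewrite !normrM norm_cis mulr1 !norm_real_complex.
by rewrite lerD2l ler_wpM2l ?ler0c //; exact: complex_norm_le.
Qed.

Lemma is_derive1_cexp z : is_derive z 1 (@cexp R : C -> C) (cexp z).
Proof.
pose quot (h : C) : C :=
  h^-1 *: (((@cexp R : C -> C) \o shift z) (h *: (1 : C)) - (cexp z : C)).
suff quot_cvg : quot @ 0^' --> (cexp z : C).
  by apply: DeriveDef; [apply/cvg_ex; exists (cexp z) | exact: cvg_lim].
have -> : quot = (fun h : C => cexp z * (h^-1 * (cexp h - 1)) : C).
  by apply/funext => h; rewrite /quot /= /GRing.scale /= mulr1 cexpD; ring.
rewrite -[X in _ --> X]mulr1.
by apply: cvgM; [exact: cvg_cst | exact: cvg_cexp_quotient].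
Qed.

Lemma cvg_real_complex (u : R^nat) (l : R) :
  u @ \oo --> l -> (fun k => (u k)%:C%C : C) @ \oo --> (l%:C%C : C).
Proof.
move=> /cvgrPdist_le u_cvg; apply/cvgrPdist_le => _ /pos_complexP[e e_gt0 ->].
move: (u_cvg e e_gt0); apply: filterS => k.
by rewrite -rmorphB norm_real_complex lecR.
Qed.

Lemma cvg_series_inv_fact :
  series (fun k => k`!%:R^-1 : C) @ \oo --> (cexp (1 : C) : C).
Proof.
have -> : series (fun k => k`!%:R^-1 : C) =
    (fun k => (series (exp_coeff (1 : R)) k)%:C%C).
  apply/funext => k; rewrite /series /= rmorph_sum /=; apply: eq_bigr => i _.
  by rewrite /exp_coeff /= expr1n mul1r fmorphV rmorph_nat.
have -> : cexp (1 : C) = (expR 1)%:C%C by exact: cexp_real.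
apply: cvg_real_complex.
exact: is_cvg_series_exp_coeff.
Qed.

End complex_exponential.

(** * The coefficients of exp(z / (1 - z)) *)

Section coefficient.
Local Open Scope classical_set_scope.
Variable R : realType.
Local Notation C := (R[i] : numFieldType).

Let w (z : C) : C := (1 - z)^-1.

Definition exp_mobius (z : C) : C := cexp (z / (1 - z)).

Local Notation f := exp_mobius.

Lemma exp_mobiusE u : u != 1 -> f u = cexp (-1) * cexp (w u).
Proof.
move=> u_neq1; rewrite -cexpD /exp_mobius /w; congr cexp.
by field; rewrite subr_eq0 eq_sym.
Qed.

Lemma is_derive1_exp_mobius (z : C) : z != 1 -> is_derive z 1 f (w z ^+ 2 * f z).
Proof.
move=> z_neq1.
have w_der : is_derive z 1 w (w z ^+ 2) by exact: is_derive1_inv1B.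
have cexp_der : is_derive (w z) 1 (@cexp R : C -> C) (cexp (w z)).
  exact: is_derive1_cexp.
have cexp_w_der := is_derive1_chain C w_der cexp_der.
apply: (@near_eq_is_derive C C C (fun u => (cexp (-1) : C) * (cexp (w u) : C))).
  by near=> u; rewrite exp_mobiusE //; near: u; exact: near_neq.
have := is_deriveZ (cexp (-1) : C) cexp_w_der.
by move/is_derive_eq; apply; rewrite exp_mobiusE // /GRing.scale /=; ring.
Unshelve. all: by end_near. Qed.

(** The Taylor coefficient of index N + 1 of f at the point z, as
    [derive1n_exp_mobius] shows. *)
Definition lah_fun N (z : C) : C := ('X^(N.+2) * lah_poly C N).[w z] * f z.

Lemma is_derive1_lah_fun N (z : C) : z != 1 ->
  is_derive z 1 (lah_fun N) (N.+2%:R * lah_fun N.+1 z).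
Proof.
move=> z_neq1.
have w_der : is_derive z 1 w (w z ^+ 2) by exact: is_derive1_inv1B.
pose p := 'X^(N.+2) * lah_poly C N.
have p_der := is_derive1_chain C w_der (is_derive1_horner _ p (w z)).
have := is_deriveM p_der (is_derive1_exp_mobius z z_neq1).
move/is_derive_eq; apply; rewrite /lah_fun -/p.
have /(congr1 (horner^~ (w z))) := lah_poly_rec C N.
rewrite hornerZ 2!hornerD hornerZ 2!hornerM hornerX => rec.
transitivity (w z ^+ N.+3 * (N.+2%:R * (lah_poly C N.+1).[w z]) * f z); last first.
  by rewrite hornerM hornerXn; move: (w z ^+ N.+3) => v; ring.
rewrite rec /p derivM derivXn hornerD !hornerM hornerMn !hornerXn /GRing.scale /=.
rewrite -mulr_natl hornerX !exprS expr0.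
by move: (w z) (w z ^+ N) => u uN; ring.
Qed.

(** The claim is made at all z != 1, not only at 0: differentiating
    the formula at a point needs it in a neighbourhood of that point. *)
Lemma derive1n_exp_mobius N (z : C) : z != 1 ->
  derive1n N.+1 f z = N.+1`!%:R * lah_fun N z.
Proof.
elim: N z => [|N IHN] z z_neq1.
  rewrite derive1nS derive1n0 derive1E.
  have [_ ->] := is_derive1_exp_mobius z z_neq1.
  rewrite /lah_fun hornerM hornerXn (_ : 1`!%:R = 1) // mul1r /lah_poly.
  by rewrite horner_poly big_ord1 expr0 /lah_coef bin0 divr1 !mulr1.
rewrite derive1nS derive1E.
rewrite (@near_eq_derive C C C _ (fun u => N.+1`!%:R * lah_fun N u)); last first.
  by near=> u; apply: IHN; near: u; exact: near_neq.
have [_ ->] := is_deriveZ (N.+1`!%:R : C) (is_derive1_lah_fun N z z_neq1).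
by rewrite /GRing.scale /= mulrA -natrM mulnC -factS.
Unshelve. all: by end_near. Qed.

Lemma maclaurin_coef_exp_mobius N :
  maclaurin_coef f N.+1 = \sum_(m < N.+1) lah_coef C N m.
Proof.
rewrite /maclaurin_coef derive1n_exp_mobius; last by rewrite eq_sym oner_eq0.
rewrite mulrAC divff ?mul1r; last by rewrite pnatr_eq0 -lt0n fact_gt0.
rewrite /lah_fun /exp_mobius /w mul0r cexp0 mulr1 subr0 invr1.
rewrite hornerM hornerXn expr1n mul1r.
by rewrite horner_poly; apply: eq_bigr => i _; rewrite expr1n mulr1.
Qed.

Lemma cvg_series_shift {u : C^nat} {l : C} m : series u @ \oo --> l ->
  series (fun k => (m <= k)%N%:R * u (k - m)%N) @ \oo --> l.
Proof.
move=> u_cvg; rewrite -(cvg_shiftn m) /=.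
rewrite (_ : (fun n => _) = series u) //; apply/funext => n.
rewrite series_addn /series /= big_nat big1 ?add0r => [|i /andP[_ lt_im]].
  rewrite -{1}[m]add0n big_addn addnK.
  by apply: eq_bigr => i _; rewrite leq_addl mul1r addnK.
by rewrite leqNgt lt_im mul0r.
Qed.

Lemma kummerM_lah N :
  kummerM (N.+2%:R : C) 2 1 = (\sum_(m < N.+1) lah_coef C N m) * cexp (1 : C).
Proof.
apply: cvg_lim; first exact: norm_hausdorff.
pose shifted m := series (fun k => (m <= k)%N%:R * (k - m)`!%:R^-1 : C).
have -> : series (fun k => pochhammer (N.+2%:R : C) k * 1 ^+ k
                           / (pochhammer 2 k * k`!%:R)) =
    (fun n => \sum_(m < N.+1) lah_coef C N m * shifted m n).
  apply/funext => n; rewrite /series /=.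
  under eq_bigr do rewrite kummer_term.
  by rewrite exchange_big /=; apply: eq_bigr => m _; rewrite mulr_sumr.
rewrite mulr_suml.
apply: cvg_big => [|m _]; first exact: add_continuous.
apply: cvgM; first exact: cvg_cst.
exact: (cvg_series_shift m (cvg_series_inv_fact R)).
Qed.

End coefficient.

Theorem lemma1 (R : realType) (n : nat) (hn : (1 <= n)%N) :
  maclaurin_coef (fun z : R[i] => cexp (z / (1 - z))) n =
  cexp (-1) * kummerM (n.+1%:R : R[i]) 2 1.
Proof.
case: n hn => // N _.
rewrite kummerM_lah (maclaurin_coef_exp_mobius R N).
by rewrite mulrCA -cexpD addNr cexp0 mulr1.
Qed.
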